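(* Fix $p\in(0,1)$ and an irrational $\alpha\in\mathbb{R}$. Let $p_j/q_j$ denote the regular continued fraction convergents of $\alpha$ and $r_j/s_j$ the $p$-convergents of $\alpha$. Let $n$ be a positive integer and let $m$ and $\ell$ be such that $r_n/s_n=p_m/q_m$ and $r_{n+1}/s_{n+1}=p_{m+\ell}/q_{m+\ell}$. Then $$\ell\le\log_\varphi\left(2^{4/p-1}\sqrt5\,\frac{\Gamma\big(1+\frac1p\big)^2}{\Gamma\big(1+\frac2p\big)}\right),$$ where $\varphi=\frac12(1+\sqrt5)$.
   Context: Regular convergents: if $\alpha=b_0+\frac{1}{b_1+}\frac{1}{b_2+}\cdots$ is the regular continued fraction of $\alpha$, then $p_n/q_n=b_0+\frac1{b_1+}\cdots\frac1{b_n}$, i.e. $p_n=b_np_{n-1}+p_{n-2}$, $q_n=b_nq_{n-1}+q_{n-2}$ for $n\ge0$, with $p_{-2}=0,p_{-1}=1,q_{-2}=1,q_{-1}=0$. $p$-convergents (the convergents of the $p$-continued fraction): for $p\in(0,1)$, $F^{\langle p\rangle}(x,y)=(|x|^p+|y|^p)^{1/p}$, and for $t>0$, $F_t^{\langle p\rangle}(x,y)=F^{\langle p\rangle}(t^{-1}x,ty)$. For $P\in\mathbb{R}^2$ put $\mathcal{B}_t(P)=\{P'\in\mathbb{R}^2: F_t^{\langle p\rangle}(P')<F_t^{\langle p\rangle}(P)\}$. A lattice is admissible for a set $S$ if the only lattice point inside $S$ is the origin. Let $L_\alpha=(0,1)\mathbb{Z}+(1,-\alpha)\mathbb{Z}$.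 Set $P_{-1}=(0,1)$, $t_{-1}=1$. Given $P_m$ and $t_m$ ($m\ge -1$), let $t_{m+1}$ be the largest $T\geq t_m$ such that $L_\alpha$ is admissible for $\mathcal{B}_t(P_m)$ for all $t\in[t_m,T]$, and let $P_{m+1}$ be the (unique) point of $L_\alpha$ with maximal $x$-coordinate among the finitely many $P'\in L_\alpha$ with $F^{\langle p\rangle}_{t_{m+1}}(P')=F^{\langle p\rangle}_{t_{m+1}}(P_m)$. Write $P_m=(x_m,y_m)$, $s_m=x_m$ and $r_m=y_m+x_m\alpha\in\mathbb{Z}$ for $m\ge0$. The $p$-convergents are $r_m/s_m$, $m\ge0$; they form a subsequence of the regular convergents. *)

(* Defs.v *)
From HB Require Import structures.
From mathcomp Require Import all_boot all_order all_algebra.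
From mathcomp Require Import all_classical all_reals all_analysis.

Set Implicit Arguments.
Unset Strict Implicit.
Unset Printing Implicit Defensive.

Import Order.TTheory GRing.Theory Num.Theory.
Import numFieldNormedType.Exports.

Local Open Scope classical_set_scope.
Local Open Scope ring_scope.

(* Regular continued fraction *)

Fixpoint complete_quotient (R : realType) (alpha : R) (n : nat) : R :=
  if n is n'.+1 then
    let x := complete_quotient alpha n' in (x - (Num.floor x)%:~R)^-1
  else alpha.

Definition partial_quotient (R : realType) (alpha : R) (n : nat) : int :=
  Num.floor (complete_quotient alpha n).

(* The recurrence c_n = b_n c_(n-1) + c_(n-2) started from c_(-2) = u and
   c_(-1) = v, with indices shifted by two: [cf_rec alpha u v k] is c_(k-2). *)
Fixpoint cf_rec (R : realType) (alpha : R) (u v : int) (k : nat) : int :=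
  match k with
  | 0 => u
  | 1 => v
  | (k''.+1 as k').+1 =>
      partial_quotient alpha k'' * cf_rec alpha u v k' + cf_rec alpha u v k''
  end.

Definition cf_num (R : realType) (alpha : R) (n : nat) : int :=
  cf_rec alpha 0 1 n.+2.

Definition cf_den (R : realType) (alpha : R) (n : nat) : int :=
  cf_rec alpha 1 0 n.+2.

(* p-continued fraction *)

Definition Fp (R : realType) (p : R) (P : R * R) : R :=
  (`|P.1| `^ p + `|P.2| `^ p) `^ p^-1.

Definition Fpt (R : realType) (p t : R) (P : R * R) : R :=
  Fp p (t^-1 * P.1, t * P.2).

Definition Bpt (R : realType) (p t : R) (P : R * R) : set (R * R) :=
  [set P' | Fpt p t P' < Fpt p t P].

Definition lattice (R : realType) (alpha : R) : set (R * R) :=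
  [set P | exists a b : int, P = (0, 1) *~ a + (1, - alpha) *~ b].

Definition admissible (R : realType) (L S : set (R * R)) : Prop :=
  L `&` S = [set (0, 0)].

Definition largest (R : realType) (A : set R) (T : R) : Prop :=
  A T /\ ubound A T.

(* Indices are shifted by one, the construction starting at m = -1:
   [P k] and [t k] are P_(k-1) and t_(k-1). *)
Definition p_continued_fraction (R : realType) (p alpha : R)
    (P : nat -> R * R) (t : nat -> R) : Prop :=
  [/\ P 0 = (0, 1),
      t 0 = 1,
      forall k : nat,
        largest [set T | t k <= T /\
                   forall u, t k <= u <= T ->
                     admissible (lattice alpha) (Bpt p u (P k))]
                (t k.+1)
    & forall k : nat,
        let S := lattice alpha `&`
          [set P' | Fpt p (t k.+1) P' = Fpt p (t k.+1) (P k)] in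
        S (P k.+1) /\ forall P', S P' -> P'.1 <= (P k.+1).1].

Definition pcf_den (R : realType) (P : nat -> R * R) (m : nat) : R :=
  (P m.+1).1.

Definition pcf_num (R : realType) (alpha : R) (P : nat -> R * R) (m : nat) : R :=
  (P m.+1).2 + (P m.+1).1 * alpha.

Definition Gamma (R : realType) (x : R) : R :=
  \int[lebesgue_measure]_(t in `]0, +oo[) (t `^ (x - 1) * expR (- t)).

Definition golden_ratio (R : realType) : R := 2^-1 * (1 + Num.sqrt 5).

Definition logb (R : realType) (b x : R) : R := ln x / ln b.

(* Main.v *)
Require Import Defs.
From mathcomp Require Import all_boot all_order all_algebra ring lra.
From mathcomp Require Import all_classical all_reals all_analysis.
From mathcomp Require Import measurable_realfun.
Import Order.TTheory GRing.Theory Num.Theory.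
Import numFieldNormedType.Exports.
Local Open Scope classical_set_scope.
Local Open Scope ring_scope.

(* Put s = 1/p and r = F_t(P_n) = F_t(P_(n+1)) at t = t_(n+1). Admissibility of
   the star body F_t < r, which contains the diamond
   |x|/t + t|y| < 2^(1-s) r, forces r^2 <= 2^(2s-1). Hence
   q_(m+l) |q_m alpha - p_m| <= r^2 <= 2^(2s-1), whereas the recurrence gives
   phi^l <= (4/3) sqrt 5 q_(m+l) |q_m alpha - p_m| for l >= 2. It remains to see
   that (4/3) Gamma(1+2s) <= 4^s Gamma(1+s)^2 for s >= 1: the ratio of the two
   sides improves from s to s + 1 by the functional equation, and on [1, 2]
   the inequality follows from Wendel's Gamma(a+t) <= a^t Gamma(a). *)

(** * The Gamma function *)

(** Weighted mean inequality for [u] and 1: with [w = 1 - t + t u], the bound [ln v <= v - 1] is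
    taken at [u / w] with weight [t] and at [1 / w] with weight [1 - t]; the right-hand sides
    cancel. *)
Lemma powR_le_tangent {R : realType} {t u : R} : 0 < t <= 1 -> 0 < u ->
  u `^ t <= 1 - t + t * u.
Proof.
move=> /andP[t0 t1] u0.
have w0 : 0 < 1 - t + t * u by nra.
have lnB (v : R) : 0 < v -> ln v <= v - 1.
  by move=> v0; rewrite -[v in ln v](subrKC 1) le_ln1Dx// ltrBrDr addNr.
have h1 := lnB _ (divr_gt0 u0 w0).
have h2 : ln (1 - t + t * u)^-1 <= (1 - t + t * u)^-1 - 1.
  by apply: lnB; rewrite invr_gt0.
rewrite -ler_ln ?posrE ?powR_gt0// ln_powR.
rewrite ln_div ?posrE// in h1; rewrite lnV ?posrE// in h2.
have e : t * (u / (1 - t + t * u) - 1) + (1 - t) * ((1 - t + t * u)^-1 - 1) = 0.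
  by field; rewrite gt_eqF.
nra.
Qed.

Lemma cvg_powR_at0 {R : realType} (b : R) : 0 <= b ->
  x `^ b @[x --> 0^'+] --> (0 : R) `^ b.
Proof.
rewrite le_eqVlt => /predU1P[<-|b0].
  rewrite powRr0; under eq_cvg do rewrite powRr0.
  exact: cvg_cst.
by rewrite powR0 ?gt_eqF//; exact: powR_cvg0.
Qed.

(** For [x >= 1], [x^b <= x^n], and one term of the exponential series gives
    [e^x >= x^(n+1) / (n+1)!], so the product is at most [(n+1)! / x]. *)
Lemma cvg_powR_expRN {R : realType} (b : R) :
  x `^ b * expR (- x) @[x --> +oo] --> (0 : R).
Proof.
pose n := Num.bound `|b|.
have bn : b <= n%:R by rewrite (le_trans (ler_norm _))// ltW// archi_boundP.
apply: (@squeeze_cvgr _ _ _ _ (fun=> 0) (fun x => n.+1`!%:R * x^-1)).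
- near=> x.
  have x1 : 1 <= x by near: x; apply: nbhs_pinfty_ge; rewrite num_real.
  have x0 : 0 < x by lra.
  rewrite mulr_ge0 ?powR_ge0 ?expR_ge0//=.
  rewrite expRN -ler_pdivlMr ?invr_gt0 ?expR_gt0// invrK.
  apply: (le_trans (ler_powR x1 bn)); rewrite powR_mulrn ?(ltW x0)//.
  have := expR_ge1Dxn n (ltW x0).
  set f := n.+1`!%:R => h.
  have f0 : 0 < f :> R by rewrite ltr0n fact_gt0.
  have : x ^+ n.+1 / f <= expR x by apply: le_trans h; rewrite lerDr.
  rewrite ler_pdivrMr// exprS => h2.
  by rewrite -mulrA (mulrC x^-1) mulrA ler_pdivlMr// mulrC (mulrC f).
- exact: cvg_cst.
- rewrite -(mulr0 (n.+1`!%:R)); apply: cvgMr.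
  by apply/gtr0_cvgV0; [exact: nbhs_pinfty_gt|exact: cvg_id].
Unshelve. all: by end_near. Qed.

(** Kept in the extended reals so that the functional equation and Wendel's inequality come first
    and finiteness is deduced from them. *)
Definition gammaE {R : realType} (a : R) : \bar R :=
  (\int[lebesgue_measure]_(x in `]0%R, +oo[) (x `^ (a - 1) * expR (- x))%:E)%E.

Lemma GammaE {R : realType} (a : R) : Gamma a = fine (gammaE a).
Proof. by []. Qed.

Lemma measurable_gamma {R : realType} (D : set R) (b : R) :
  measurable_fun D (EFin \o (fun x : R => x `^ b * expR (- x))).
Proof.
apply/measurable_EFinP; apply: measurable_funTS; apply: measurable_funM.
  exact: measurable_powR.
by apply: measurableT_comp => //; exact: measurable_funN.
Qed.

Lemma gammaE_ge0 {R : realType} (a : R) : (0 <= gammaE a)%E.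
Proof.
by apply: integral_ge0 => x _; rewrite lee_fin mulr_ge0 ?powR_ge0 ?expR_ge0.
Qed.

Lemma is_derive_expRN {R : realType} (x : R) :
  is_derive x 1 (fun y : R => expR (- y)) (- expR (- x)).
Proof.
have h : is_derive x 1 (-%R : R -> R) (-1) by exact: is_deriveN.
by rewrite -mulrN1; exact: is_derive1_comp.
Qed.

Lemma is_derive_gammaF {R : realType} (a C x : R) : 0 < x ->
  is_derive x 1 (fun y : R => - ((y `^ a + C) * expR (- y)))
    ((x `^ a - a * x `^ (a - 1) + C) * expR (- x)).
Proof.
move=> x0; have h1 := is_derive1_powR a x0.
have h2 := is_derive_expRN x.
by apply: is_derive_eq; rewrite /GRing.scale /=; ring.
Qed.

Lemma gammaE1 {R : realType} : gammaE (1 : R) = 1%E.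
Proof.
rewrite /gammaE subrr; under eq_integral do rewrite powRr0 mul1r.
rewrite integral_itv_obnd_cbnd; last first.
  apply/measurable_EFinP; apply: measurable_funTS.
  by apply: measurableT_comp => //; exact: measurable_funN.
have cN : continuous (fun x : R => expR (- x)).
  by move=> x; apply: continuous_comp; [exact: opp_continuous|exact: continuous_expR].
rewrite (@ge0_continuous_FTC2y _ _ (fun x => - expR (- x)) _ 0)//.
- by rewrite oppr0 expR0 -EFinB opprK add0r.
- exact: continuous_subspaceT.
- by rewrite -oppr0; apply: cvgN; exact: cvgr_expR.
- by apply: cvgN; apply/cvg_at_right_filter; exact: cN.
- move=> x _; have h := is_derive_expRN x.
  by rewrite derive1E derive_val opprK.
Qed.

Lemma gammaES {R : realType} (a : R) : 1 <= a ->
  (gammaE (a + 1) = a%:E * gammaE a)%E.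
Proof.
move=> a1.
(* The constant [C] makes the derivative [f] of [F] nonnegative, so that no
   finiteness of the integrals is needed. *)
pose C := a `^ a.
have C0 : 0 <= C by exact: powR_ge0.
pose f x := (x `^ a - a * x `^ (a - 1) + C) * expR (- x).
pose F x := - ((x `^ a + C) * expR (- x)).
have f0 x : 0 <= x -> 0 <= f x.
  move=> x0; rewrite mulr_ge0 ?expR_ge0//.
  rewrite -{1}(mulr_powRB1 x0); last lra.
  have p0 := powR_ge0 x (a - 1).
  (* For [x >= a], [x^a] outweighs [a x^(a-1)]; for [x < a], the constant [C = a^a] does. *)
  have [ax|/ltW xa] := leP a x; first by nra.
  have h : x `^ (a - 1) <= a `^ (a - 1) by rewrite ge0_ler_powR ?nnegrE//; lra.
  have : a * x `^ (a - 1) <= C.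
    by rewrite /C -(@mulr_powRB1 _ a a) ?ler_wpM2l//; lra.
  nra.
have cN : continuous (fun x : R => expR (- x)).
  by move=> x; apply: continuous_comp; [exact: opp_continuous|exact: continuous_expR].
have If : (\int[lebesgue_measure]_(x in `[0%R, +oo[) (f x)%:E = C%:E)%E.
  rewrite (@ge0_continuous_FTC2y _ f F 0 0)//.
  - rewrite /F powR0 ?gt_eqF//; last lra.
    by rewrite oppr0 expR0 add0r mulr1 add0r EFinN oppeK.
  - apply/continuous_within_itvcyP; split; last first.
      apply: cvgM; last by apply/cvg_at_right_filter; exact: cN.
      apply: cvgD; last exact: cvg_cst.
      apply: cvgB; first by apply: cvg_powR_at0; lra.
      by apply: cvgM; [exact: cvg_cst|apply: cvg_powR_at0; lra].
    move=> x; rewrite in_itv/= andbT => x0.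
    have cp b : {for x, continuous (fun y : R => y `^ b)}.
      apply: differentiable_continuous; apply/derivable1_diffP.
      by apply: derivable_powR; rewrite in_itv/= x0.
    apply: cvgM; last exact: cN.
    apply: cvgD; last exact: cvg_cst.
    apply: cvgB; first exact: cp.
    by apply: cvgM; [exact: cvg_cst|exact: cp].
  - rewrite -oppr0; apply: cvgN; rewrite /=.
    have -> : (fun x => (x `^ a + C) * expR (- x)) =
        (fun x => x `^ a * expR (- x)) \+ (fun x => C * expR (- x)).
      by apply/funext => x /=; rewrite mulrDl.
    have h := cvgD (cvg_powR_expRN a) (cvgM (cvg_cst C) (@cvgr_expR R)).
    by rewrite mulr0 addr0 in h; exact: h.
  - by move=> x x0; have h := is_derive_gammaF a C x x0; exact: ex_derive.
  - apply: cvgN; apply: cvgM; last by apply/cvg_at_right_filter; exact: cN.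
    by apply: cvgD; [apply: cvg_powR_at0; lra|exact: cvg_cst].
  - move=> x; rewrite in_itv/= andbT => x0.
    have h := is_derive_gammaF a C x x0.
    by rewrite derive1E derive_val.
have mexpRN : measurable_fun setT (fun x : R => expR (- x)).
  by apply: measurableT_comp => //; exact: measurable_funN.
have mE (g : R -> R) : measurable_fun [set: R] g ->
    measurable_fun (`]0, +oo[ : set R) (fun x : R => (g x * expR (- x))%:E).
  by move=> mg; apply/measurable_EFinP; apply: measurable_funTS; exact: measurable_funM.
have mp b := @measurable_powR R b.
have mf : measurable_fun (`]0, +oo[ : set R) (EFin \o f).
  apply: mE; apply: measurable_funD => //; apply: measurable_funB => //.
  exact: measurable_funM.
(* [C + a Gamma(a)] and [C + Gamma(a+1)] are both identified with [I]; the finite [C] then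
   cancels. *)
pose I := (\int[lebesgue_measure]_(x in `]0%R, +oo[)
             ((x `^ a + C) * expR (- x))%:E)%E.
have a0 : 0 <= a by lra.
have g0 b x : (0 <= (x `^ b * expR (- x))%:E :> \bar R)%E.
  by rewrite lee_fin mulr_ge0 ?powR_ge0 ?expR_ge0.
have e1 : (C%:E + a%:E * gammaE a = I)%E.
  rewrite -[in LHS]If -integral_itv_obnd_cbnd; last exact: mf.
  rewrite /gammaE -ge0_integralZl_EFin//.
  rewrite -ge0_integralD//.
  - by apply: eq_integral => x _; rewrite -EFinM -EFinD; congr EFin; rewrite /f; ring.
  - by move=> x; rewrite /= in_itv/= andbT => /ltW /f0; rewrite lee_fin.
  - by move=> x _; rewrite mule_ge0.
  - by apply: measurable_funeM; exact: mE.
  - exact: mE.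
have e2 : (C%:E + gammaE (a + 1) = I)%E.
  rewrite -[in LHS](mule1 C%:E) -gammaE1 addeC.
  rewrite /gammaE -ge0_integralZl_EFin//.
  rewrite -ge0_integralD//.
  - apply: eq_integral => x _; rewrite -EFinM -EFinD; congr EFin.
    by rewrite subrr powRr0 addrK; ring.
  - exact: mE.
  - by move=> x _; rewrite mule_ge0.
  - by apply: measurable_funeM; exact: mE.
  - exact: mE.
have := congr1 (fun z => z - C%:E)%E (etrans e1 (esym e2)).
by rewrite !(addeC C%:E) !addeK// => ->.
Qed.

(** The tangent bound at [u = x / a] is integrated against [x^(a-1) e^(-x)]; by the functional
    equation the weights [1 - t] and [t / a] recombine to [Gamma(a)]. *)
Lemma gammaE_wendel {R : realType} (a t : R) : 1 <= a -> 0 < t <= 1 ->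
  (gammaE (a + t) <= (a `^ t)%:E * gammaE a)%E.
Proof.
move=> a1 t01; have a0 : 0 < a by lra.
have /andP[t0 t1] := t01.
have mE b : measurable_fun (`]0, +oo[ : set R) (fun x : R => (x `^ b * expR (- x))%:E).
  exact: measurable_gamma.
have E : ((a `^ t)%:E * gammaE a = \int[lebesgue_measure]_(x in `]0%R, +oo[)
   ((a `^ t * (1 - t))%:E * (x `^ (a - 1) * expR (- x))%:E +
    (a `^ t * (t / a))%:E * (x `^ (a + 1 - 1) * expR (- x))%:E))%E.
  have ge0 b x : (0 <= (x `^ b * expR (- x))%:E :> \bar R)%E.
    by rewrite lee_fin mulr_ge0 ?powR_ge0 ?expR_ge0.
  have c1 : 0 <= a `^ t * (1 - t) by rewrite mulr_ge0 ?powR_ge0//; lra.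
  have c2 : 0 <= a `^ t * (t / a) by rewrite mulr_ge0 ?powR_ge0// divr_ge0//; lra.
  rewrite ge0_integralD//; last 4 first.
  - by move=> x _; rewrite mule_ge0.
  - by apply: measurable_funeM; exact: mE.
  - by move=> x _; rewrite mule_ge0.
  - by apply: measurable_funeM; exact: mE.
  rewrite !ge0_integralZl_EFin// -/(gammaE (a + 1)) -/(gammaE a).
  rewrite (gammaES a a1) muleA -EFinM.
  rewrite -ge0_muleDl ?lee_fin//; last by rewrite mulr_ge0// ltW.
  by rewrite -EFinD; congr (_%:E * _)%E; field; rewrite gt_eqF.
  exact: mE.
  exact: mE.
rewrite E; apply: ge0_le_integral => //=.
- by move=> x _; rewrite lee_fin mulr_ge0 ?powR_ge0 ?expR_ge0.
- exact: mE.
- by apply: emeasurable_funD; apply: measurable_funeM; exact: mE.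
move=> x; rewrite in_itv/= andbT => x0.
rewrite -!EFinM -EFinD lee_fin.
have -> : a + t - 1 = t + (a - 1) by ring.
have -> : a + 1 - 1 = 1 + (a - 1) by ring.
have xn0 : x != 0 by rewrite gt_eqF.
rewrite (@powRD _ _ t) ?xn0 ?implybT// (@powRD _ _ 1) ?xn0 ?implybT//.
rewrite powRr1 ?(ltW x0)//.
have h : x `^ t <= a `^ t * (1 - t + t * (x / a)).
  rewrite -{1}(divfK (lt0r_neq0 a0) x) mulrC powRM ?(ltW a0) ?(ltW (divr_gt0 x0 a0))//.
  by rewrite ler_wpM2l ?powR_ge0//; exact/powR_le_tangent/divr_gt0.
have w : 0 <= x `^ (a - 1) * expR (- x) by rewrite mulr_ge0 ?powR_ge0 ?expR_ge0.
have := ler_wpM2r w h; congr (_ <= _); first by ring.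
by field; rewrite gt_eqF.
Qed.

(** Carries facts about Gamma from a unit interval to a half-line by the functional equation; the
    induction is on a natural number bounding [a - b]. *)
Lemma real_unit_ind {R : realType} (Q : R -> Prop) (b : R) :
  (forall a, b <= a <= b + 1 -> Q a) ->
  (forall a, b <= a -> Q a -> Q (a + 1)) ->
  forall a, b <= a -> Q a.
Proof.
move=> Q0 QS a ba.
have [n an] : exists n : nat, a <= b + n%:R.
  exists (Num.bound `|a - b|).
  by rewrite addrC -lerBlDr (le_trans (ler_norm _))// ltW// archi_boundP.
elim: n a ba an => [|n IHn] a ba an; first by apply: Q0; lra.
have [ab|/ltW ab] := leP a (b + 1); first by apply: Q0; rewrite ba.
rewrite -(subrK 1 a); apply: QS; first lra.
by apply: IHn; [lra|move: an; rewrite -natr1; lra].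
Qed.

(** On []1, 2]], Wendel's inequality from the base point 1 gives the bound 1; the functional
    equation does the rest. *)
Lemma gammaE_fin {R : realType} (a : R) : 1 <= a -> gammaE a \is a fin_num.
Proof.
move: a; apply: real_unit_ind => a a1.
  have /andP[] := a1; rewrite le_eqVlt => /predU1P[<- _|{}a1 a2].
    by rewrite gammaE1.
  rewrite ge0_fin_numE ?gammaE_ge0// -(subrKC 1 a).
  apply: le_lt_trans (gammaE_wendel 1 (a - 1) (lexx _) _) _; first lra.
  by rewrite gammaE1 mule1 ltry.
by move=> h; rewrite (gammaES a a1) fin_numM.
Qed.

Lemma Gamma1 {R : realType} : Gamma 1 = 1 :> R.
Proof. by rewrite GammaE gammaE1. Qed.

Lemma GammaS {R : realType} (a : R) : 1 <= a -> Gamma (a + 1) = a * Gamma a.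
Proof. by move=> a1; rewrite !GammaE (gammaES a a1) fineM// gammaE_fin. Qed.

Lemma Gamma_wendel {R : realType} (a t : R) : 1 <= a -> 0 <= t <= 1 ->
  Gamma (a + t) <= a `^ t * Gamma a.
Proof.
move=> a1 /andP[]; rewrite le_eqVlt => /predU1P[<- _|t0 t1].
  by rewrite addr0 powRr0 mul1r.
rewrite !GammaE -lee_fin EFinM !fineK ?gammaE_fin//; last lra.
by apply: gammaE_wendel => //; rewrite t0.
Qed.

(** Wendel's inequality from [a] up to 2 reads [1 <= a^(2-a) Gamma(a)]; multiply by [a^(a-1)]. *)
Lemma Gamma_ge_powR {R : realType} (a : R) : 1 <= a <= 2 -> a `^ (a - 1) <= Gamma (a + 1).
Proof.
move=> a12; rewrite GammaS; last lra.
have a0 : 0 < a by lra.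
have := @Gamma_wendel R a (2 - a); rewrite subrKC -[2]/(1 + 1 : R) GammaS// Gamma1 mulr1.
move=> /(_ ltac:(lra) ltac:(lra)) h.
have := ler_wpM2l (powR_ge0 a (a - 1)) h.
rewrite mulr1 mulrA -powRD; last by rewrite (gt_eqF a0) implybT.
by rewrite (_ : a - 1 + _ = 1) ?powRr1 ?(ltW a0)//; ring.
Qed.

Lemma Gamma_gt0 {R : realType} (a : R) : 1 <= a -> 0 < Gamma a.
Proof.
move: a; apply: real_unit_ind => a a1; last by move=> h; rewrite GammaS// mulr_gt0//; lra.
have a0 : 0 < a by lra.
have := lt_le_trans (powR_gt0 (a - 1) a0) (Gamma_ge_powR a a1).
by rewrite GammaS ?pmulr_rgt0//; lra.
Qed.

(** * Comparison of Gamma(1+2s) with 4^s Gamma(1+s)^2 *)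

Lemma Gamma2 {R : realType} : Gamma 2 = 1 :> R.
Proof. by rewrite -[2]/(1 + 1 : R) GammaS// Gamma1 mulr1. Qed.

Lemma Gamma3 {R : realType} : Gamma 3 = 2 :> R.
Proof.
have h : 1 <= 2 :> R by lra.
by have := GammaS _ h; rewrite Gamma2 mulr1 (_ : 2 + 1 = 3); last ring.
Qed.

Lemma Gamma4 {R : realType} : Gamma 4 = 6 :> R.
Proof.
have h : 1 <= 3 :> R by lra.
have e1 : 3 + 1 = 4 :> R by ring.
have e2 : 3 * 2 = 6 :> R by ring.
by have := GammaS _ h; rewrite Gamma3 e1 e2.
Qed.

(** The left side gains the factor [(2s+1)(2s+2)], the right side the larger
    [4 (s+1)^2 = (2s+2)^2]. *)
Lemma Gamma_duplication_leS {R : realType} (s : R) : 1 <= s ->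
  4 / 3 * Gamma (1 + 2 * s) <= 2 `^ (2 * s) * Gamma (1 + s) ^+ 2 ->
  4 / 3 * Gamma (1 + 2 * (s + 1)) <= 2 `^ (2 * (s + 1)) * Gamma (1 + (s + 1)) ^+ 2.
Proof.
move=> s1.
have k1 : 0 <= 2 * s + 1 by lra.
have k2 : 0 <= 2 * s + 2 by lra.
have k3 : 2 * s + 1 <= 2 * s + 2 by lra.
have k4 : 0 <= 4 / 3 :> R by lra.
have a1 : 1 <= 1 + s by lra.
have a2 : 1 <= 1 + 2 * s by lra.
have a3 : 1 <= 1 + 2 * s + 1 by lra.
have -> : Gamma (1 + (s + 1)) = (1 + s) * Gamma (1 + s) by rewrite addrA GammaS.
have -> : Gamma (1 + 2 * (s + 1)) = (1 + 2 * s + 1) * ((1 + 2 * s) * Gamma (1 + 2 * s)).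
  by rewrite -(GammaS _ a2) -(GammaS _ a3); congr Gamma; ring.
have -> : 2 `^ (2 * (s + 1)) = 2 `^ (2 * s) * 4.
  rewrite mulrDr mulr1 powRD; last by rewrite pnatr_eq0 implybT.
  by rewrite -[in X in _ * X]/(2%:R) powR_mulrn// expr2 -natrM.
move: (ltW (Gamma_gt0 _ a2)) => + IH; move: IH.
move: (Gamma (1 + 2 * s)) (Gamma (1 + s)) (2 `^ (2 * s)) => g h w IH g0.
have : (2 * s + 1) * (2 * s + 2) * (4 / 3 * g) <= (2 * s + 2) ^+ 2 * (w * h ^+ 2).
  apply: ler_pM IH; [exact: mulr_ge0|exact: mulr_ge0|].
  by rewrite expr2 ler_wpM2r.
by congr (_ <= _); ring.
Qed.

(** Wendel from 3 with increment [2s - 2], and [Gamma(1+s) >= s^(s-1) >= 1]. What remains, [e32],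
    amounts to [(3/2)^(2s) <= (3/2)^3], sharp at [s = 3/2]. *)
Lemma Gamma_duplication_le_3half {R : realType} (s : R) : 1 <= s <= 3 / 2 ->
  4 / 3 * Gamma (1 + 2 * s) <= 2 `^ (2 * s) * Gamma (1 + s) ^+ 2.
Proof.
move=> s1.
have w0 : 0 < 2 `^ (2 * s) :> R by rewrite powR_gt0.
have e32 : 4 / 3 * (3 `^ (2 * s - 2) * 2) <= 2 `^ (2 * s) :> R.
  have : (3 / 2) `^ (2 * s) <= (3 / 2) `^ 3 :> R by rewrite ler_powR//; lra.
  rewrite [X in _ <= X]powR_mulrn; last lra.
  have -> : 3 `^ (2 * s - 2) = (3 / 2) `^ (2 * s) * 2 `^ (2 * s) / 9 :> R.
    rewrite -powRM ?divfK ?pnatr_eq0//; try lra.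
    by rewrite powRB ?pnatr_eq0 ?implybT// powR_mulrn// expr2 -natrM.
  have -> : (3 / 2 : R) ^+ 3 = 27 / 8 by field.
  move: w0; move: (2 `^ _) ((3 / 2) `^ _) => w v w0 hv; nra.
have h : Gamma (1 + 2 * s) <= 3 `^ (2 * s - 2) * 2.
  have := Gamma_wendel (3 : R) (2 * s - 2) ltac:(lra) ltac:(lra).
  by rewrite Gamma3 (_ : 3 + (2 * s - 2) = 1 + 2 * s); last ring.
have G1 : 1 <= Gamma (1 + s).
  rewrite addrC (le_trans _ (Gamma_ge_powR s _))//; last lra.
  by rewrite -[leLHS](powRr0 s) ler_powR//; lra.
apply: le_trans (_ : 2 `^ (2 * s) <= _).
  by apply: le_trans e32; rewrite ler_wpM2l//; lra.
rewrite ler_peMr ?(ltW w0)// expr2; move: G1.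
by move: (Gamma _) => g g1; nra.
Qed.

(** Wendel from 4 with increment [2s - 3], and [Gamma(1+s) >= s 2^(s-2)]; what remains reduces to
    [s^2 >= 2]. *)
Lemma Gamma_duplication_le_2 {R : realType} (s : R) : 3 / 2 <= s <= 2 ->
  4 / 3 * Gamma (1 + 2 * s) <= 2 `^ (2 * s) * Gamma (1 + s) ^+ 2.
Proof.
move=> s1; have s0 : 0 < s by lra.
have s12 : 1 <= s <= 2 by lra.
have e4 : 4 `^ (2 * s - 3) = (2 `^ (2 * s)) ^+ 2 / 64 :> R.
  rewrite powRB ?pnatr_eq0 ?implybT// (@powR_mulrn _ 4 3)// -natrX.
  by rewrite [in RHS]expr2 -powRM// -natrM.
have e2 : (2 `^ (s - 2)) ^+ 2 = 2 `^ (2 * s) / 16 :> R.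
  rewrite -powR_mulrn ?powR_ge0// -powRrM mulrBl powRB ?pnatr_eq0 ?implybT//.
  by rewrite (mulrC s) -natrM powR_mulrn// -natrX.
(* Since [s <= 2] and the exponent [s - 2] is at most 0, [s^(s-2) >= 2^(s-2)]. *)
have h1 : s * 2 `^ (s - 2) <= s `^ (s - 1).
  have -> : s `^ (s - 1) = s * s `^ (s - 2).
    rewrite -[X in X * _](powRr1 (ltW s0)) -powRD; last by rewrite (gt_eqF s0) implybT.
    by congr (_ `^ _); ring.
  rewrite ler_wpM2l ?(ltW s0)// -!(opprB 2 s) !powRN lef_pV2 ?posrE ?powR_gt0//.
  by rewrite ge0_ler_powR ?nnegrE//; lra.
have w0 : 0 < 2 `^ (2 * s) :> R by rewrite powR_gt0.
have h2 : 4 / 3 * (4 `^ (2 * s - 3) * 6) <=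
    2 `^ (2 * s) * (s ^+ 2 * (2 `^ (2 * s) / 16)).
  rewrite e4; move: w0; move: (2 `^ (2 * s)) => w w0.
  have -> : 4 / 3 * (w ^+ 2 / 64 * 6) = w * (2 * (w / 16)) by field.
  by rewrite ler_wpM2l ?(ltW w0)// ler_wpM2r ?expr2; nra.
have h3 : 0 <= s * 2 `^ (s - 2) by rewrite mulr_ge0 ?powR_ge0// ltW.
have t1 : 0 <= 2 * s - 3 <= 1 by lra.
have t2 : 1 <= 4 :> R by lra.
have t3 : 0 <= 4 / 3 :> R by lra.
have e5 : 4 + (2 * s - 3) = 1 + 2 * s by ring.
have h : Gamma (1 + 2 * s) <= 4 `^ (2 * s - 3) * 6.
  by rewrite -Gamma4 -e5; exact: Gamma_wendel.
have G1 : s * 2 `^ (s - 2) <= Gamma (1 + s).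
  by rewrite (addrC 1 s); exact: le_trans h1 (Gamma_ge_powR _ s12).
apply: le_trans (ler_wpM2l t3 h) _; apply: le_trans h2 _.
rewrite ler_wpM2l ?(ltW w0)// -e2 -exprMn lerXn2r ?nnegrE//.
exact: le_trans G1.
Qed.

Lemma Gamma_duplication_le {R : realType} (s : R) : 1 <= s ->
  4 / 3 * Gamma (1 + 2 * s) <= 2 `^ (2 * s) * Gamma (1 + s) ^+ 2.
Proof.
move: s; apply: real_unit_ind => s s1; last exact: Gamma_duplication_leS.
have [s32|/ltW s32] := leP s (3 / 2).
  by apply: Gamma_duplication_le_3half; lra.
by apply: Gamma_duplication_le_2; lra.
Qed.

(** * Regular convergents *)

Lemma complete_quotient_irrational {R : realType} (alpha : R) n :
  irrational alpha -> irrational (complete_quotient alpha n).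
Proof.
move=> irr; elim: n => //= n IHn [q _ qE]; apply: IHn.
exists (q^-1 + (Num.floor (complete_quotient alpha n))%:~R) => //.
by rewrite rmorphD/= fmorphV/= ratr_int qE invrK subrK.
Qed.

Lemma irrational_floor_lt {R : realType} (x : R) :
  irrational x -> (Num.floor x)%:~R < x.
Proof.
move=> irr; rewrite lt_neqAle floor_le andbT; apply/eqP => xE; apply: irr.
by exists (Num.floor x)%:~R => //; rewrite ratr_int.
Qed.

Lemma complete_quotientS_gt1 {R : realType} (alpha : R) n :
  irrational alpha -> 1 < complete_quotient alpha n.+1.
Proof.
move=> irr /=.
have h := irrational_floor_lt _ (complete_quotient_irrational alpha n irr).
rewrite invf_gt1 ?subr_gt0//.
by have := floorD1_gt (complete_quotient alpha n); rewrite intrD; lra.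
Qed.

Lemma complete_quotientE {R : realType} (alpha : R) n : irrational alpha ->
  complete_quotient alpha n =
  (partial_quotient alpha n)%:~R + (complete_quotient alpha n.+1)^-1.
Proof. by rewrite /partial_quotient /= invrK addrC subrK. Qed.

Lemma partial_quotientS_ge1 {R : realType} (alpha : R) n :
  irrational alpha -> 1 <= partial_quotient alpha n.+1.
Proof.
by move=> irr; rewrite floor_ge_int ltW// complete_quotientS_gt1.
Qed.

(* These carry the index shift of [cf_rec]: the convergent p_m/q_m is
   [cfp m.+2 / cfq m.+2]. *)
Definition cfp {R : realType} (alpha : R) (k : nat) : int := cf_rec alpha 0 1 k.
Definition cfq {R : realType} (alpha : R) (k : nat) : int := cf_rec alpha 1 0 k.

Definition cf_err {R : realType} (alpha : R) (k : nat) : R :=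
  `|(cfq alpha k)%:~R * alpha - (cfp alpha k)%:~R|.

Lemma cfpSS {R : realType} (alpha : R) k :
  cfp alpha k.+2 = partial_quotient alpha k * cfp alpha k.+1 + cfp alpha k.
Proof. by []. Qed.

Lemma cfqSS {R : realType} (alpha : R) k :
  cfq alpha k.+2 = partial_quotient alpha k * cfq alpha k.+1 + cfq alpha k.
Proof. by []. Qed.

(** Writing [d_k] for the signed error and [x_k] for the complete quotient, the induction step is
    [d_(k+2) = b_k d_(k+1) + d_k = (b_k - x_k) d_(k+1) = - d_(k+1) / x_(k+1)]. *)
Lemma cf_delta {R : realType} (alpha : R) k : irrational alpha ->
  (cfq alpha k)%:~R * alpha - (cfp alpha k)%:~R =
  - (complete_quotient alpha k *
     ((cfq alpha k.+1)%:~R * alpha - (cfp alpha k.+1)%:~R)).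
Proof.
move=> irr; elim: k => [|k IHk]; first by rewrite /=; ring.
have x0 : complete_quotient alpha k.+1 != 0.
  by rewrite gt_eqF// (lt_trans ltr01 (complete_quotientS_gt1 _ _ irr)).
rewrite cfpSS cfqSS !intrD !intrM.
move: IHk x0; rewrite (complete_quotientE alpha k irr).
move: (complete_quotient _ _) => y IHk y0.
rewrite [X in _ = - (_ * X)](_ : _ = - (y^-1 *
  ((cfq alpha k.+1)%:~R * alpha - (cfp alpha k.+1)%:~R))).
  by rewrite mulrN opprK mulVKf.
transitivity ((partial_quotient alpha k)%:~R *
    ((cfq alpha k.+1)%:~R * alpha - (cfp alpha k.+1)%:~R) +
  ((cfq alpha k)%:~R * alpha - (cfp alpha k)%:~R)); first by ring.
by rewrite IHk; ring.
Qed.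

(** The absolute value of the quotient is there for [k = 0], where it is [alpha] itself, possibly
    negative. *)
Lemma cf_errS {R : realType} (alpha : R) k : irrational alpha ->
  cf_err alpha k = `|complete_quotient alpha k| * cf_err alpha k.+1.
Proof. by move=> irr; rewrite /cf_err (cf_delta alpha k irr) normrN normrM. Qed.

Lemma cf_err1 {R : realType} (alpha : R) : cf_err alpha 1 = 1.
Proof. by rewrite /cf_err/= mul0r sub0r normrN1. Qed.

Lemma cf_err_le {R : realType} (alpha : R) k : irrational alpha ->
  cf_err alpha k.+2 <= cf_err alpha k.+1.
Proof.
move=> irr; rewrite (cf_errS alpha k.+1 irr) ler_peMl ?normr_ge0//.
by rewrite (le_trans _ (ler_norm _))// ltW// complete_quotientS_gt1.
Qed.

Lemma cf_err_gt0 {R : realType} (alpha : R) k : irrational alpha ->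
  0 < cf_err alpha k.+1.
Proof.
move=> irr; elim: k => [|k]; first by rewrite cf_err1.
rewrite (cf_errS alpha k.+1 irr) pmulr_rgt0// normr_gt0 gt_eqF//.
exact: lt_trans ltr01 (complete_quotientS_gt1 _ _ irr).
Qed.

Lemma cf_err_le1 {R : realType} (alpha : R) k : irrational alpha ->
  cf_err alpha k.+1 <= 1.
Proof.
move=> irr; elim: k => [|k]; first by rewrite cf_err1.
exact: le_trans (cf_err_le alpha k irr).
Qed.

Lemma cf_errSS {R : realType} (alpha : R) k : irrational alpha ->
  cf_err alpha k.+1 =
  (partial_quotient alpha k.+1)%:~R * cf_err alpha k.+2 + cf_err alpha k.+3.
Proof.
move=> irr; have x1 n := complete_quotientS_gt1 alpha n irr.
have x0 n : 0 < complete_quotient alpha n.+1 := lt_trans ltr01 (x1 n).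
rewrite (cf_errS alpha k.+1 irr) (cf_errS alpha k.+2 irr) !ger0_norm ?ltW//.
rewrite {1}(complete_quotientE alpha k.+1 irr) mulrDl; congr (_ + _).
by rewrite mulKf// gt_eqF.
Qed.

(** The determinant identity in absolute values: the recurrences of denominators and errors leave
    the left side invariant, and it is 1 at [k = 0]. *)
Lemma cf_err_det {R : realType} (alpha : R) k : irrational alpha ->
  (cfq alpha k.+2)%:~R * cf_err alpha k.+1 +
  (cfq alpha k.+1)%:~R * cf_err alpha k.+2 = 1.
Proof.
move=> irr; elim: k => [|k IHk].
  by rewrite cf_err1 cfqSS /= !(mulr0, mul0r, add0r, addr0, mulr1).
rewrite -[RHS]IHk (cf_errSS alpha k irr) (cfqSS _ k.+1) intrD intrM; ring.
Qed.

Lemma cfq_ge {R : realType} (alpha : R) k : irrational alpha ->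
  0 <= cfq alpha k.+1 /\ 1 <= cfq alpha k.+2.
Proof.
move=> irr; elim: k => [|k [q0 q1]]; first by rewrite cfqSS /= mulr0.
split; first exact: le_trans q1.
rewrite cfqSS (le_trans q1)// ler_wpDr// ler_peMl//; first exact: le_trans q1.
exact: partial_quotientS_ge1.
Qed.

Lemma cfq_fib {R : realType} (alpha : R) k : irrational alpha ->
  cfq alpha k.+2 + cfq alpha k.+1 <= cfq alpha k.+3.
Proof.
move=> irr; have [_ q1] := cfq_ge alpha k irr.
rewrite (cfqSS _ k.+1) lerD2r ler_peMl ?partial_quotientS_ge1//.
exact: le_trans q1.
Qed.

(** Makes the denominators unbounded, and gives [m <= 1] when [q_m = 1]. *)
Lemma cfq_ge_nat {R : realType} (alpha : R) k : irrational alpha ->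
  k%:Z <= cfq alpha k.+2.
Proof.
move=> irr; case: k => [|k]; first by have [_] := cfq_ge alpha 0 irr; exact: le_trans.
elim: k => [|k IHk]; first by have [] := cfq_ge alpha 1 irr.
apply: le_trans (cfq_fib alpha k.+1 irr); have [_ q1] := cfq_ge alpha k irr.
by rewrite intS addrC lerD.
Qed.

Lemma cfp_cfq_coprime {R : realType} (alpha : R) k :
  coprimez (cfp alpha k) (cfq alpha k).
Proof.
have D : cfp alpha k.+1 * cfq alpha k - cfp alpha k * cfq alpha k.+1 = (-1) ^+ k.
  elim: k => [|k IHk]; first by rewrite /=; ring.
  by rewrite cfpSS cfqSS exprS -IHk; ring.
(* The determinant identity times its own sign is a Bezout relation. *)
apply/coprimezP; exists (- (-1) ^+ k * cfq alpha k.+1, (-1) ^+ k * cfp alpha k.+1) => /=.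
have e : (-1) ^+ k * (-1) ^+ k = 1 :> int by rewrite -exprMn mulrNN mulr1 expr1n.
by rewrite -[RHS]e -[X in _ = _ * X]D; ring.
Qed.

(** * Admissible lattices and growth of denominators *)

(** The vectors [(u0, v0)] and [(u1, -v1)] span a lattice of determinant 1 in absolute value; 2 is
    Minkowski's constant for the diamond, attained by the vector of smaller l1 norm. *)
Lemma adjacent_diamond {R : realFieldType} (u0 v0 u1 v1 : R) :
  0 <= u0 <= v0 -> 0 <= v1 <= u1 -> u1 * v0 + u0 * v1 = 1 ->
  (u0 + v0) ^+ 2 <= 2 \/ (u1 + v1) ^+ 2 <= 2.
Proof.
have aux (a b c d : R) : 0 <= a <= b -> 0 <= d <= c -> c * b + a * d = 1 ->
    a + b <= c + d -> (a + b) ^+ 2 <= 2.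
  move=> ab dc e le_m; rewrite expr2.
  (* Let [S = a + b]. If [S <= 2d], then [c >= d] gives [cb + ad >= dS >= S^2 / 2]; otherwise
     [c >= S - d] gives [cb + ad >= bS - d(b - a) >= S^2 / 2]. *)
  have [h|h] := leP (a + b) (2 * d); first by nra.
  nra.
move=> uv0 uv1 e; have [h|/ltW h] := leP (u0 + v0) (u1 + v1).
  by left; exact: (aux _ _ _ _ uv0 uv1 e h).
right; rewrite addrC; apply: (aux v1 u1 v0 u0) => //; last by rewrite addrC [leRHS]addrC.
by rewrite -e; ring.
Qed.

Lemma cf_diamond {R : realType} (alpha t : R) : irrational alpha -> 0 < t ->
  exists k, ((cfq alpha k.+1)%:~R / t + t * cf_err alpha k.+1) ^+ 2 <= 2.
Proof.
move=> irr t0.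
pose Q k := t * cf_err alpha k.+1 < (cfq alpha k.+1)%:~R / t.
(* The diamond contains one of the two convergents at which |x|/t overtakes t|y|. *)
have [k Qk] : exists k, Q k.
  (* Here the denominator is at least [N > t^2], while the error is at most 1. *)
  pose N := Num.bound (t ^+ 2); exists N.+1.
  rewrite /Q ltr_pdivlMr// mulrC mulrA -expr2.
  apply: (@le_lt_trans _ _ (t ^+ 2)).
    by rewrite ler_piMr ?sqr_ge0// cf_err_le1.
  apply: lt_le_trans (archi_boundP (sqr_ge0 t)) _.
  by rewrite -[leLHS]/(N%:Z%:~R) ler_int cfq_ge_nat.
have exQ : exists k, Q k by exists k.
case: (ex_minnP exQ) => {k Qk exQ} -[|k] Qk min.
  (* [Q 0] concerns the formal convergent 1/0, with denominator 0 and error 1, and would read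
     [t < 0]. *)
  by move: Qk; rewrite /Q /= mul0r cf_err1 mulr1 ltNge ltW.
have nQ : ~~ Q k by apply/negP => /min; rewrite ltnn.
have q0 j : 0 <= (cfq alpha j.+1)%:~R :> R by rewrite ler0z (cfq_ge _ _ irr).1.
have := @adjacent_diamond _ ((cfq alpha k.+1)%:~R / t) (t * cf_err alpha k.+1)
  ((cfq alpha k.+2)%:~R / t) (t * cf_err alpha k.+2).
case.
- by rewrite divr_ge0 ?(ltW t0)//= leNgt.
- by rewrite mulr_ge0 ?normr_ge0 ?(ltW t0)//= ltW.
- rewrite -[RHS](cf_err_det alpha k irr); field; exact: lt0r_neq0.
- by exists k.
- by exists k.+1.
Qed.

(** Hölder with exponents [1/p] and [1/(1-p)] against the vector [(1, 1)], then the power [1/p]. *)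
Lemma Fp_le {R : realType} (p : R) (x : R * R) : 0 < p < 1 ->
  Fp p x <= 2 `^ (p^-1 - 1) * (`|x.1| + `|x.2|).
Proof.
move=> /andP[p0 p1]; rewrite /Fp.
have s0 : 0 < p^-1 by rewrite invr_gt0.
have r0 : 0 < (1 - p)^-1 by rewrite invr_gt0 subr_gt0.
have := @hoelder2 R (`|x.1| `^ p) (`|x.2| `^ p) 1 1 p^-1 (1 - p)^-1.
rewrite !invrK !mulr1 -!powRrM !mulfV ?gt_eqF// !powRr1// powR1.
move=> /(_ (powR_ge0 _ _) (powR_ge0 _ _) ler01 ler01 s0 r0 (subrKC _ _)) h.
apply: (le_trans (ge0_ler_powR (ltW s0) _ _ h)).
- by rewrite nnegrE addr_ge0 ?powR_ge0.
- by rewrite nnegrE mulr_ge0 ?powR_ge0.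
rewrite powRM ?powR_ge0// -!powRrM mulfV ?gt_eqF// powRr1 ?addr_ge0//.
rewrite mulrC ler_wpM2r ?addr_ge0//.
by rewrite mulrBl mul1r mulfV ?gt_eqF.
Qed.

Lemma Fp_ge {R : realType} (p : R) (x : R * R) : 0 < p ->
  `|x.1| <= Fp p x /\ `|x.2| <= Fp p x.
Proof.
move=> p0; have s0 : 0 <= p^-1 by rewrite invr_ge0 ltW.
have K (y : R) : (`|y| `^ p) `^ p^-1 = `|y|.
  by rewrite -powRrM mulfV ?gt_eqF// powRr1.
rewrite -{1}(K x.1) -{1}(K x.2) /Fp.
split; apply: ge0_ler_powR; rewrite ?nnegrE ?addr_ge0 ?powR_ge0//.
  by rewrite lerDl powR_ge0.
by rewrite lerDr powR_ge0.
Qed.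

Lemma latticeP {R : realType} (alpha : R) (x : R * R) :
  lattice alpha x <-> exists a b : int, x = (b%:~R, a%:~R - b%:~R * alpha).
Proof.
have E (a b : int) : (0, 1) *~ a + (1, - alpha) *~ b =
    (b%:~R, a%:~R - b%:~R * alpha) :> R * R.
  apply: injective_projections => /=.
    by rewrite !(raddfMz fst)/= mul0rz add0r.
  by rewrite !(raddfMz snd)/= mulNrz mulrzl.
by split=> -[a [b ->]]; exists a, b; rewrite E.
Qed.

Lemma golden_ratioE {R : realType} :
  golden_ratio R ^+ 2 = golden_ratio R + 1.
Proof.
have : Num.sqrt 5 ^+ 2 = 5 :> R by rewrite sqr_sqrtr.
by rewrite /golden_ratio; move: (Num.sqrt 5) => r e; nra.
Qed.

(** Two consecutive exponents are carried together, since [phi^(l+2) = phi^(l+1) + phi^l]. Exponent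
    1 is excluded: for [u 0 = u 1 > 0] it would need [2 phi <= (4/3) sqrt 5]. *)
Lemma fib_growth {R : realType} (u : nat -> R) l :
  0 <= u 0 <= u 1 -> (forall n, u n.+1 + u n <= u n.+2) ->
  golden_ratio R ^+ l.+2 * (u 1 + u 0) <= 4 / 3 * Num.sqrt 5 * u l.+2.
Proof.
move=> u01 uS.
have r5 : Num.sqrt 5 ^+ 2 = 5 :> R by rewrite sqr_sqrtr.
have r0 : 2 <= Num.sqrt 5 :> R.
  by rewrite -[leLHS]ger0_norm// -sqrtr_sqr ler_sqrt// expr2; lra.
pose K : R := 4 / 3 * Num.sqrt 5.
have gE := @golden_ratioE R.
have K0 : 0 <= K by rewrite /K; lra.
suff: golden_ratio R ^+ l.+2 * (u 1 + u 0) <= K * u l.+2 /\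
      golden_ratio R ^+ l.+3 * (u 1 + u 0) <= K * u l.+3 by case.
elim: l => [|l [IH1 IH2]].
  (* As [u 0 <= u 1], [u 3 >= 2 u 1 + u 0 >= (3/2)(u 1 + u 0)], and
     [phi^3 = 2 + sqrt 5 <= 2 sqrt 5]. *)
  have u2 := uS 0; have u3 := uS 1.
  split; last first.
    apply: le_trans (_ : K * (3 / 2 * (u 1 + u 0)) <= _); last first.
      by rewrite ler_wpM2l//; lra.
    rewrite mulrA ler_wpM2r//; first lra.
    rewrite exprS gE mulrDr mulr1 -expr2 gE /K /golden_ratio; lra.
  apply: le_trans (_ : K * (u 1 + u 0) <= _); last by rewrite ler_wpM2l.
  rewrite ler_wpM2r//; first lra.
  by rewrite gE /K /golden_ratio; lra.
split=> //.
apply: le_trans (_ : K * (u l.+3 + u l.+2) <= _); last by rewrite ler_wpM2l.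
rewrite -(addn2 l.+2) exprD gE [X in X * _]mulrDr mulr1 -exprSr mulrDl.
by rewrite [leRHS]mulrDr lerD.
Qed.

(* If [x.1 = 0], the hypothesis reads [0 = p_m / q_m], so [q_m = 1] and [m <= 1]. *)
Lemma lattice_fraction {R : realType} (alpha : R) (x : R * R) m :
  irrational alpha -> lattice alpha x -> x <> (0, 0) ->
  (x.2 + x.1 * alpha) / x.1 = (cf_num alpha m)%:~R / (cf_den alpha m)%:~R ->
  cf_err alpha m.+2 <= `|x.2| /\
  ((cfq alpha m.+2)%:~R <= `|x.1| \/ (m <= 1)%N).
Proof.
move=> irr /latticeP[a [b ->]] x0 /=; rewrite subrK.
rewrite /cf_num /cf_den -/(cfp alpha m.+2) -/(cfq alpha m.+2).
have cpq := cfp_cfq_coprime alpha m.+2.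
have [_ q1] := cfq_ge alpha m irr.
have q0 : cfq alpha m.+2 != 0 by rewrite gt_eqF// (lt_le_trans _ q1).
have [b0|b0] := eqVneq b 0.
  rewrite b0 invr0 mulr0 mul0r subr0 => /esym/eqP.
  rewrite mulf_eq0 invr_eq0 !intr_eq0 (negPf q0) orbF => /eqP p0.
  split.
    apply: le_trans (cf_err_le1 alpha m.+1 irr) _.
    rewrite -intr_norm ler1z -gtz0_ge1 normr_gt0; apply/eqP => a0.
    by apply: x0; rewrite a0 b0 mul0r subr0.
  right; move: cpq; rewrite p0 /coprimez gcd0z => /eqP[q1'].
  have := cfq_ge_nat alpha m irr; rewrite -[cfq _ _]gez0_abs ?(le_trans _ q1)//.
  by rewrite q1'.
move=> /eqP; rewrite eqr_div ?intr_eq0// -!intrM eqr_int => /eqP e.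
(* By coprimality [(b, a)] is a nonzero integer multiple [k] of [(q_m, p_m)], so both bounds follow
   from [|k| >= 1]. *)
have : (cfq alpha m.+2 %| b)%Z.
  rewrite -(@Gauss_dvdzr _ (cfp alpha m.+2)) 1?coprimez_sym// -e.
  exact: dvdz_mull.
case/dvdzP => k bE.
have k0 : k != 0 by apply: contra_neq b0; rewrite bE => ->; rewrite mul0r.
have aE : a = k * cfp alpha m.+2.
  by apply: (mulIf q0); rewrite e bE; ring.
have k1 : 1 <= `|k%:~R| :> R by rewrite -intr_norm ler1z -gtz0_ge1 normr_gt0.
split.
  rewrite aE bE !intrM -mulrA -mulrBr normrM distrC.
  by rewrite ler_peMl ?normr_ge0.
left; rewrite bE intrM normrM (le_trans (ler_norm _))// ler_peMl//.
Qed.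

Lemma admissible_radius {R : realType} (p alpha t : R) (x : R * R) :
  0 < p < 1 -> irrational alpha -> 0 < t ->
  admissible (lattice alpha) (Bpt p t x) ->
  Fpt p t x ^+ 2 <= 2 `^ (2 * p^-1 - 1).
Proof.
move=> p01 irr t0 adm.
have [k hk] := cf_diamond alpha t irr t0.
set d := _ + _ in hk.
pose y : R * R := ((cfq alpha k.+1)%:~R,
  (cfp alpha k.+1)%:~R - (cfq alpha k.+1)%:~R * alpha).
have y2 : `|y.2| = cf_err alpha k.+1 by rewrite /= distrC.
have Ly : lattice alpha y by apply/latticeP; exists (cfp alpha k.+1), (cfq alpha k.+1).
(* The lattice point [y] is not the origin, its second coordinate being a positive error up to sign,
   so it lies outside the body. *)
have xy : Fpt p t x <= Fpt p t y.
  rewrite leNgt; apply/negP => yx.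
  have : (lattice alpha `&` Bpt p t x) y by split.
  rewrite adm => y0; have := cf_err_gt0 alpha k irr.
  by rewrite -y2 y0 normr0 ltxx.
have x0 : 0 <= Fpt p t x by exact: powR_ge0.
have yd : Fpt p t y <= 2 `^ (p^-1 - 1) * d.
  apply: le_trans (Fp_le _ _ p01) _.
  rewrite ler_wpM2l ?powR_ge0//= !normrM normfV -/(y.2) y2 !(gtr0_norm t0) mulrC.
  by rewrite ger0_norm// ler0z (cfq_ge _ _ irr).1.
have -> : 2 `^ (2 * p^-1 - 1) = (2 `^ (p^-1 - 1)) ^+ 2 * 2 :> R.
  rewrite (_ : 2 * p^-1 - 1 = (p^-1 - 1) * 2 + 1); last by ring.
  rewrite powRD; last by rewrite pnatr_eq0 implybT.
  by rewrite powRr1// powRrM powR_mulrn ?powR_ge0.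
apply: le_trans (_ : (2 `^ (p^-1 - 1) * d) ^+ 2 <= _).
  have xd := le_trans xy yd.
  by rewrite lerXn2r ?nnegrE//; exact: le_trans x0 xd.
by rewrite exprMn ler_wpM2l ?sqr_ge0.
Qed.

(** Split [2^(4s-1) = 2^(2s) 2^(2s-1)] and divide by [2^(2s-1) sqrt 5]. *)
Lemma Gamma_bound_ge {R : realType} (p : R) : 0 < p < 1 ->
  4 / 3 * Num.sqrt 5 * 2 `^ (2 * p^-1 - 1) <=
  2 `^ (4 / p - 1) * Num.sqrt 5 * (Gamma (1 + 1 / p) ^+ 2 / Gamma (1 + 2 / p)).
Proof.
move=> /andP[p0 p1]; rewrite div1r; set s := p^-1.
have s1 : 1 <= s by rewrite invf_ge1// ltW.
have g0 : 0 < Gamma (1 + 2 * s) by apply: Gamma_gt0; lra.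
have : 4 / 3 <= 2 `^ (2 * s) * (Gamma (1 + s) ^+ 2 / Gamma (1 + 2 * s)).
  by rewrite mulrA ler_pdivlMr//; exact: Gamma_duplication_le.
have -> : 4 * s - 1 = 2 * s + (2 * s - 1) by ring.
rewrite (@powRD _ _ (2 * s) (2 * s - 1)); last by rewrite pnatr_eq0 implybT.
have : 0 <= Num.sqrt 5 * 2 `^ (2 * s - 1) :> R by rewrite mulr_ge0 ?powR_ge0 ?sqrtr_ge0.
move: (Gamma _ ^+ 2 / _) (2 `^ (2 * s)) (2 `^ (2 * s - 1)) (Num.sqrt (5 : R)).
move=> g a b c w h; have := ler_wpM2l w h.
by congr (_ <= _); ring.
Qed.

(** Each of [|y.1| / t] and [t |x.2|] is at most the common value of [F_t]; in the product [t]
    cancels. *)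
Lemma admissible_pair {R : realType} (p alpha t : R) (x y : R * R) :
  0 < p < 1 -> irrational alpha -> 0 < t ->
  admissible (lattice alpha) (Bpt p t x) -> Fpt p t y = Fpt p t x ->
  `|y.1| * `|x.2| <= 2 `^ (2 * p^-1 - 1).
Proof.
move=> p01 irr t0 adm yx.
have r2 := admissible_radius p alpha t x p01 irr t0 adm.
have [p0 _] := andP p01; have tN0 := lt0r_neq0 t0.
have [h2 _] := Fp_ge p (t^-1 * y.1, t * y.2) p0.
have [_ h1] := Fp_ge p (t^-1 * x.1, t * x.2) p0.
rewrite /= !normrM normfV (gtr0_norm t0) in h1 h2.
have -> : `|y.1| * `|x.2| = t^-1 * `|y.1| * (t * `|x.2|) by field.
apply: le_trans r2; rewrite expr2; apply: ler_pM h1; last by rewrite -yx.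
  by rewrite mulr_ge0 ?invr_ge0 ?(ltW t0).
by rewrite mulr_ge0 ?(ltW t0).
Qed.

(** * The golden ratio estimate and its logarithm *)

Lemma golden_ratio_gt1 {R : realType} : 1 < golden_ratio R.
Proof.
rewrite /golden_ratio; suff : 2 <= Num.sqrt 5 :> R by lra.
by rewrite -[leLHS]ger0_norm// -sqrtr_sqr ler_sqrt// expr2; lra.
Qed.

Lemma le_logb {R : realType} (b v : R) (l : nat) :
  1 < b -> b ^+ l <= v -> l%:R <= logb b v.
Proof.
move=> b1 h; have b0 : 0 < b := lt_trans ltr01 b1.
rewrite /logb ler_pdivlMr ?ln_gt0// mulr_natl -lnXn//.
have w0 : 0 < b ^+ l by rewrite exprn_gt0.
by rewrite ler_ln ?posrE// (lt_le_trans w0).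
Qed.

(** For [l <= 1], which [m + l <= 1] implies, [c >= 1] and [phi <= (4/3) sqrt 5] suffice. For
    [l >= 2] the growth bound applies to [u k = q_(m+k)]. *)
Lemma golden_ratioX_le {R : realType} (alpha c x y : R) (m l : nat) :
  irrational alpha -> 1 <= c ->
  cf_err alpha m.+2 <= y ->
  (cfq alpha (m + l).+2)%:~R <= x \/ (m + l <= 1)%N ->
  x * y <= c ->
  golden_ratio R ^+ l <= 4 / 3 * Num.sqrt 5 * c.
Proof.
move=> irr c1 errY qX xy.
have phi1 := @golden_ratio_gt1 R.
have phi0 : 0 < golden_ratio R := lt_trans ltr01 phi1.
have K0 : 0 <= 4 / 3 * Num.sqrt 5 :> R by rewrite mulr_ge0 ?sqrtr_ge0.
have l1 : (l <= 1)%N -> golden_ratio R ^+ l <= 4 / 3 * Num.sqrt 5 * c.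
  move=> l1; apply: le_trans (_ : golden_ratio R <= _).
    by rewrite -[leRHS]expr1 ler_weXn2l// ltW.
  apply: le_trans (_ : 4 / 3 * Num.sqrt 5 * 1 <= _); last by rewrite ler_wpM2l.
  by move: phi1; rewrite /golden_ratio; lra.
have [/l1//|l2] := leqP l 1.
case: qX => [qX|ml]; last by apply: l1; rewrite (leq_trans (leq_addl m l)).
case: l l2 {l1} qX => [|[|l]]// _ qX.
pose u k : R := (cfq alpha (m + k).+2)%:~R.
have uS k : u k.+1 + u k <= u k.+2.
  by rewrite /u !addnS -intrD ler_int cfq_fib.
have u1 k : 0 <= u k by rewrite /u ler0z (cfq_ge _ _ irr).1.
have u01 : 0 <= u 0 <= u 1.
  rewrite u1 /u addn1 addn0 ler_int.
  by rewrite (le_trans _ (cfq_fib alpha m irr))// lerDl (cfq_ge _ _ irr).1.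
(* The determinant identity, with the error at [m + 1] enlarged to that at [m]. *)
have e1 : 1 <= (u 1 + u 0) * cf_err alpha m.+2.
  rewrite -(cf_err_det alpha m.+1 irr) /u addn1 addn0 mulrDl lerD2l.
  by rewrite ler_wpM2l ?cf_err_le// ler0z (cfq_ge _ _ irr).1.
have w0 : 0 <= golden_ratio R ^+ l.+2 by rewrite exprn_ge0// ltW.
have err0 : 0 <= cf_err alpha m.+2 by exact: normr_ge0.
apply: le_trans (_ : golden_ratio R ^+ l.+2 * ((u 1 + u 0) * cf_err alpha m.+2) <= _).
  by rewrite ler_peMr.
rewrite mulrA.
apply: le_trans (ler_wpM2r err0 (fib_growth u l u01 uS)) _.
by rewrite -(mulrA (4 / 3 * Num.sqrt 5)) ler_wpM2l// (le_trans _ xy)// ler_pM.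
Qed.

Theorem theorem1p2 (R : realType) (p alpha : R)
    (hp : 0 < p < 1) (halpha : irrational alpha)
    (P : nat -> R * R) (t : nat -> R)
    (hP : p_continued_fraction p alpha P t)
    (n m l : nat) (hn : (0 < n)%N)
    (hm : pcf_num alpha P n / pcf_den P n =
          (cf_num alpha m)%:~R / (cf_den alpha m)%:~R)
    (hml : pcf_num alpha P n.+1 / pcf_den P n.+1 =
           (cf_num alpha (m + l))%:~R / (cf_den alpha (m + l))%:~R) :
  l%:R <= logb (golden_ratio R)
    (2 `^ (4 / p - 1) * Num.sqrt 5 *
      (Gamma (1 + 1 / p) ^+ 2 / Gamma (1 + 2 / p))).
Proof.
case: hP => _ t0E ht hS.
have t_gt0 k : 0 < t k.
  elim: k => [|k]; first by rewrite t0E.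
  by case: (ht k) => -[tk _] _ /lt_le_trans; apply.
have LP k : lattice alpha (P k.+1) by case: (hS k) => -[].
(* In shifted indices [P n.+1] is P_n and [t n.+2] is t_(n+1); admissibility is used at this right
   endpoint, where P_n and P_(n+1) have equal [F_t]. *)
have [[tT adm] _] := ht n.+1.
have {}adm := adm (t n.+2) (introT andP (conj tT (lexx _))).
have [[_ FE] _] := hS n.+1.
(* Admissibility is an equality of sets, so the origin lies in the open body and its [F_t] is
   strictly below that of P_n. *)
have P0 k : Fpt p (t n.+2) (P k) = Fpt p (t n.+2) (P n.+1) -> P k <> (0, 0).
  move=> Fk Pk0.
  have : (lattice alpha `&` Bpt p (t n.+2) (P n.+1)) (0, 0) by rewrite adm.
  by case=> _; rewrite /Bpt /= -Fk Pk0 ltxx.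
have [Yn _] := lattice_fraction alpha _ m halpha (LP n) (P0 _ erefl) hm.
have [_ Xn] := lattice_fraction alpha _ (m + l) halpha (LP n.+1) (P0 _ FE) hml.
have XY := admissible_pair p alpha _ _ _ hp halpha (t_gt0 n.+2) adm FE.
clear hm hml adm FE.
have c1 : 1 <= 2 `^ (2 * p^-1 - 1) :> R.
  rewrite -[leLHS](powRr0 (2 : R)) ler_powR ?ler1n//.
  have : 1 <= p^-1 by rewrite invf_ge1; case/andP: hp => // _ /ltW.
  lra.
apply: le_logb golden_ratio_gt1 (le_trans _ (Gamma_bound_ge p hp)).
exact: golden_ratioX_le halpha c1 Yn Xn XY.
Qed.
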